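(* For every non-negative integer $N$, \[ \sum_{\pi\in\ell\mathcal{G}_{1,2N}}q^{|\pi|}=\sum_{m,n\ge0}q^{m^2+n^2+n}{N-m\brack n}_{q^2}{n+1\brack m}_{q^2},\qquad \sum_{\pi\in\ell\mathcal{G}_{2,2N}}q^{|\pi|}=\sum_{m,n\ge0}q^{m^2+n^2+n}{N-m\brack n}_{q^2}{n\brack m}_{q^2}. \]
   Context: A partition is a finite non-decreasing sequence $\pi=(\lambda_1,\dots,\lambda_{\#(\pi)})$ of positive integers (the empty sequence is the unique partition of $0$); $|\pi|$ is the sum of its parts. For $i=1,2$ and integer $M\ge0$, $\ell\mathcal{G}_{i,M}$ is the set of partitions all of whose parts are $\ge i$ and $\le M$, with $\lambda_j-\lambda_{j-1}\ge2$ for $j\ge2$ and $\lambda_j-\lambda_{j-1}\ge3$ whenever $\lambda_j$ is odd (no consecutive odd parts). For integers $A,B$, ${A\brack B}_{q^2}=\frac{(q^2;q^2)_A}{(q^2;q^2)_B(q^2;q^2)_{A-B}}$ if $0\le B\le A$ and $0$ otherwise, where $(a;p)_j=\prod_{i=0}^{j-1}(1-ap^i)$. *)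

(* Defs.v *)
From mathcomp Require Import all_boot all_order all_algebra.
From mathcomp Require Import all_classical.

Set Implicit Arguments.
Unset Strict Implicit.
Unset Printing Implicit Defensive.

Import Order.TTheory GRing.Theory Num.Theory.

Local Open Scope classical_set_scope.
Local Open Scope ring_scope.

Definition is_partition (p : seq nat) : bool :=
  sorted leq p && all (fun x => 0 < x)%N p.

(* [sorted] tests its relation on pairs of adjacent parts only; in the relation
   below [x] is the smaller part and [y] the next one. *)
Definition little_goellnitz (i M : nat) : set (seq nat) :=
  [set p | [/\ is_partition p,
      all (fun x => i <= x <= M)%N p &
      sorted (fun x y => (x + 2 <= y) && (odd y ==> (x + 3 <= y)))%N p]].

Definition qpochhammer (F : fieldType) (a p : F) (j : nat) : F :=
  \prod_(0 <= i < j) (1 - a * p ^+ i).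

Definition qbinomial (F : fieldType) (p : F) (A B : int) : F :=
  if 0 <= B <= A then
    qpochhammer p p `|A|%N
      / (qpochhammer p p `|B|%N * qpochhammer p p `|A - B|%N)
  else 0.

(* The identities are between polynomials in an indeterminate [q]; they are
   stated in the field Q(q) because the q-binomials are quotients. *)
Definition qvar : {fraction {poly rat}} := tofrac 'X.

(* The sums [\sum_(x \in A) F x] of the statement range over sets and are 0 by
   convention when the support is infinite; the next two lemmas show that this
   never happens here. *)
Lemma finite_little_goellnitz (i M : nat) : finite_set (little_goellnitz i M).
Proof.
apply: (@sub_finite_set _ _
  (range (fun t : (M.+1).-tuple bool => mask t (iota 0 M.+1)))); last first.
  exact/finite_image/finite_finset.
move=> p [_ /allP pM p_sorted].
have p_ltn : sorted ltn p.
  apply: sub_sorted p_sorted => x y /andP[+ _].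
  by apply: leq_trans; rewrite addn2.
have Ep : [seq x <- iota 0 M.+1 | x \in p] = p.
  apply: (irr_sorted_eq ltn_trans ltnn) => //.
    exact: (sorted_filter ltn_trans _ (iota_ltn_sorted 0 M.+1)).
  move=> x; rewrite mem_filter mem_iota add0n ltnS leq0n /=.
  by case: (boolP (x \in p)) => // /pM /andP[].
have sz : size [seq x \in p | x <- iota 0 M.+1] == M.+1.
  by rewrite size_map size_iota.
by exists (Tuple sz) => //; exact: etrans (esym (filter_mask _ _)) Ep.
Qed.

Lemma finite_qbinomial_support (F : fieldType) (p : F) (N : nat)
    (c d : nat * nat -> F) :
  finite_set [set mn : nat * nat |
    c mn * qbinomial p (N%:Z - mn.1%:Z) mn.2%:Z * d mn != 0].
Proof.
apply: (@sub_finite_set _ _ (`I_N.+1 `*` `I_N.+1)); last first.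
  by apply: finite_setX; apply: finite_II.
move=> [m n] /=; rewrite /qbinomial; case: ifP => [/andP[_ le_nNm] _|_].
  have le_nmN : (n + m <= N)%N by move: le_nNm; rewrite lerBrDr -PoszD lez_nat.
  split; rewrite ltnS; apply: leq_trans le_nmN;
    [exact: leq_addl | exact: leq_addr].
by rewrite mulr0 mul0r eqxx.
Qed.

(* Main.v *)
(* Sorting the partitions by their largest part gives, for
   E_N = \sum_(p in LG_{i,2N}) q^|p|, the recurrence
     E_(N+2) = (1 + q^(2N+4)) E_(N+1) + q^(2N+3) E_N.
   The double sum satisfies it too: q-Pascal applied to [N-m, n] relates the
   terms of index (m, n+1) for N+2 and N+1, and q-Pascal applied to the other
   binomial splits their difference into the terms of index (m, n) for N+1 and
   (m-1, n) for N. *)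
Require Import Defs.
From mathcomp Require Import all_boot all_order all_algebra.
From mathcomp Require Import all_classical.
From mathcomp Require Import zify ring.

Set Implicit Arguments.
Unset Strict Implicit.
Unset Printing Implicit Defensive.

Import Order.TTheory GRing.Theory Num.Theory.

Local Open Scope classical_set_scope.
Local Open Scope ring_scope.

(** * Gaussian binomials and the two q-Pascal rules *)

Section QBinomial.
Variables (F : fieldType) (p : F).
Hypothesis p_neq1 : forall k, p ^+ k.+1 != 1.

Lemma qpochhammerS (j : nat) :
  qpochhammer p p j.+1 = qpochhammer p p j * (1 - p ^+ j.+1).
Proof. by rewrite /qpochhammer big_nat_recr //= exprS. Qed.

Lemma qpochhammer_neq0 (j : nat) : qpochhammer p p j != 0.
Proof.
elim: j => [|j IHj]; first by rewrite /qpochhammer big_geq ?oner_eq0.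
by rewrite qpochhammerS mulf_neq0 // subr_eq0 eq_sym p_neq1.
Qed.

Lemma qbinomialD (a b : nat) :
  qbinomial p (a + b)%N%:Z b%:Z =
  qpochhammer p p (a + b) / (qpochhammer p p b * qpochhammer p p a).
Proof.
rewrite /qbinomial ifT; last by lia.
by congr (_ / (_ * qpochhammer p p _)); lia.
Qed.

Lemma qbinomial_small (A : int) (b : nat) : A < b%:Z -> qbinomial p A b%:Z = 0.
Proof. by move=> ltAb; rewrite /qbinomial ifF //; lia. Qed.

Lemma qbinomialn0 (a : nat) : qbinomial p a%:Z 0 = 1.
Proof.
have := qbinomialD a 0; rewrite addn0 => ->.
rewrite [qpochhammer p p 0]/qpochhammer big_geq // mul1r divff //.
exact: qpochhammer_neq0.
Qed.

Lemma qbinomialnn (b : nat) : qbinomial p b%:Z b%:Z = 1.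
Proof.
have := qbinomialD 0 b; rewrite add0n => ->.
rewrite [qpochhammer p p 0]/qpochhammer big_geq // mulr1 divff //.
exact: qpochhammer_neq0.
Qed.

(** For [A < b] all three binomials are 0, so the absolute value in the exponent is harmless. For A
    = a+1+b, put x = p^(a+1) and y = p^(b+1): clearing denominators leaves 1 - xy = (1 - x) + x(1 -
    y). *)
Lemma qbinomial_pascal (A : int) (b : nat) :
  qbinomial p (A + 1) b.+1%:Z =
  qbinomial p A b.+1%:Z + p ^+ `|A - b%:Z|%N * qbinomial p A b%:Z.
Proof.
have [ltAb|leAb] := ltP A b%:Z.
  by rewrite !qbinomial_small ?mulr0 ?addr0 //; lia.
(* [A = b] is treated apart: the binomial over [b.+1] is then 0 by convention, not by the quotient
   formula. *)
have [[|a] EA] : exists a, A = (a + b)%N%:Z by exists `|A - b%:Z|%N; lia.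
  have -> : A + 1 = b.+1%:Z by lia.
  rewrite {}EA add0n subrr mul1r !qbinomialnn qbinomial_small ?add0r //; lia.
have -> : (`|A - b%:Z| = a.+1)%N by lia.
have -> : A + 1 = (a.+1 + b.+1)%N%:Z by lia.
rewrite {}EA (qbinomialD a.+1 b) (addSnnS a b) !qbinomialD !qpochhammerS.
have := (qpochhammer_neq0 a, qpochhammer_neq0 b).
have := (p_neq1 a, p_neq1 b).
rewrite ![_ == 1]eq_sym -![1 == _]subr_eq0 => -[pa pb] [Pa Pb].
have -> : p ^+ (a + b.+1).+1 = p ^+ a.+1 * p ^+ b.+1 by rewrite -exprD.
by field; rewrite Pa Pb pa pb.
Qed.

(** Here the weight depends on the lower index only; the identity left is 1 - xy = y(1 - x) + (1 -
    y). *)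
Lemma qbinomial_pascal_shift (A : int) (b : nat) :
  qbinomial p (A + 1) b.+1%:Z =
  p ^+ b.+1 * qbinomial p A b.+1%:Z + qbinomial p A b%:Z.
Proof.
have [ltAb|leAb] := ltP A b%:Z.
  by rewrite !qbinomial_small ?mulr0 ?addr0 //; lia.
have [[|a] EA] : exists a, A = (a + b)%N%:Z by exists `|A - b%:Z|%N; lia.
  have -> : A + 1 = b.+1%:Z by lia.
  rewrite {}EA add0n !qbinomialnn qbinomial_small ?mulr0 ?add0r //; lia.
have -> : A + 1 = (a.+1 + b.+1)%N%:Z by lia.
rewrite {}EA (qbinomialD a.+1 b) (addSnnS a b) !qbinomialD !qpochhammerS.
have := (qpochhammer_neq0 a, qpochhammer_neq0 b).
have := (p_neq1 a, p_neq1 b).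
rewrite ![_ == 1]eq_sym -![1 == _]subr_eq0 => -[pa pb] [Pa Pb].
have -> : p ^+ (a + b.+1).+1 = p ^+ a.+1 * p ^+ b.+1 by rewrite -exprD.
by field; rewrite Pa Pb pa pb.
Qed.

End QBinomial.

(** * Partitions sorted by their largest part *)

Definition gap (x y : nat) : bool :=
  ((x + 2 <= y) && (odd y ==> (x + 3 <= y)))%N.

Lemma gap_trans : transitive gap.
Proof.
move=> y x z /andP[? _] /andP[? /implyP H].
by apply/andP; split; [|apply/implyP => /H]; lia.
Qed.

Lemma gap_leq (x y : nat) : gap x y -> (x <= y)%N.
Proof. by case/andP => ? _; lia. Qed.

(** Transitivity of [gap] makes the adjacent condition pairwise, so that removing the largest part
    bounds all the others at once. *)
Lemma little_goellnitzE (i M : nat) (p : seq nat) :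
  little_goellnitz i M p <->
  all (fun x => 0 < x)%N p /\ all (fun x => i <= x <= M)%N p /\ pairwise gap p.
Proof.
rewrite /little_goellnitz /= /is_partition (sorted_pairwise gap_trans).
split=> [[/andP[_ ->] -> ->] //|[-> [-> p_gap]]]; split=> //.
rewrite andbT; apply: sub_sorted gap_leq _ _.
by rewrite (sorted_pairwise gap_trans).
Qed.

Definition goellnitz_gf (F : fieldType) (q : F) (i M : nat) : F :=
  \sum_(s \in little_goellnitz i M) q ^+ sumn s.

(* When the largest part is M.+1, the part before it is at most
   M.+1 - (2 + odd M.+1); if this truncates to 0, there is no such part. *)
Lemma little_goellnitzS (i M : nat) :
  (i <= M.+1)%N ->
  little_goellnitz i M.+1 =
  little_goellnitz i M `|`
  [set rcons s M.+1 | s in little_goellnitz i (M.+1 - (2 + odd M.+1))].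
Proof.
move=> iM; apply/seteqP; split=> s.
  move=> /little_goellnitzE; case: (lastP s) => [|{}s x].
    by move=> _; left; apply/little_goellnitzE.
  rewrite !all_rcons pairwise_rcons.
  move=> [/andP[x0 s0] [/andP[/andP[ix xM] /allP sM] /andP[/allP sx s_gap]]].
  have [xltM|Mlex] := leqP x M; [left|right].
    apply/little_goellnitzE; rewrite !all_rcons pairwise_rcons x0 s0 ix xltM.
    rewrite s_gap /= andbT.
    split=> //; split; last exact/allP.
    apply/allP => y ys; have := sM _ ys; have := gap_leq (sx _ ys); lia.
  have Ex : x = M.+1 by lia.
  exists s; rewrite -?Ex //; apply/little_goellnitzE; do 2!split=> //.
  apply/allP => y ys; have /andP[-> _] := sM _ ys.
  have /andP[? /implyP H] := sx _ ys.
  by move: H; case: (odd x) => /= [/(_ isT)|_]; lia.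
move=> [/little_goellnitzE[s0 [/allP sM s_gap]]|
        [{}s /little_goellnitzE[/allP s0 [/allP sM s_gap] <-]]].
  apply/little_goellnitzE; do 2!split=> //.
  by apply/allP => y /sM; lia.
apply/little_goellnitzE; rewrite !all_rcons pairwise_rcons s_gap iM leqnn /=.
rewrite andbT.
split; first exact/allP.
split; apply/allP => y ys; have := sM _ ys; have := s0 _ ys; first by lia.
by rewrite /gap; case: (odd M.+1) => /=; lia.
Qed.

Lemma goellnitz_gfS (F : fieldType) (q : F) (i M : nat) :
  (i <= M.+1)%N ->
  goellnitz_gf q i M.+1 =
  goellnitz_gf q i M + q ^+ M.+1 * goellnitz_gf q i (M.+1 - (2 + odd M.+1)).
Proof.
move=> iM; rewrite /goellnitz_gf little_goellnitzS // fsbigU0 /=.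
- rewrite fsbig_image /=; last by move=> s t _ _; apply: rcons_injl.
  rewrite mulr_fsumr; congr (_ + _); apply: eq_fsbigr => s _.
  by rewrite sumn_rcons addnC exprD.
- exact: finite_little_goellnitz.
- exact/finite_image/finite_little_goellnitz.
(* Disjointness: a partition ending in [M.+1] violates the bound [M]. *)
- move=> t [tM [s _ Et]]; have /little_goellnitzE[_ []] := tM.
  by rewrite -Et all_rcons ltnn andbF.
Qed.

Lemma goellnitz_gf_small (F : fieldType) (q : F) (i M : nat) :
  (M < maxn 1 i)%N -> goellnitz_gf q i M = 1.
Proof.
move=> Mi; rewrite /goellnitz_gf.
have -> : little_goellnitz i M = [set [::]].
  apply/seteqP; split=> [[|x s] //|_ ->]; last exact/little_goellnitzE.
  by move/little_goellnitzE=> /= [/andP[? _] [/andP[? _] _]]; lia.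
by rewrite fsbig_set1 expr0.
Qed.

(** Removing a largest part 2N+4 leaves the bound 2N+2; removing 2N+3 leaves 2N. With [i <= 3] both
    parts are allowed even for N = 0. *)
Lemma goellnitz_gf_rec (F : fieldType) (q : F) (i N : nat) :
  (i <= 3)%N ->
  goellnitz_gf q i (2 * N.+2) =
  (1 + q ^+ (2 * N).+4) * goellnitz_gf q i (2 * N.+1) +
  q ^+ (2 * N).+3 * goellnitz_gf q i (2 * N).
Proof.
move=> i3; have -> : (2 * N.+2 = (2 * N).+4)%N by lia.
have -> : (2 * N.+1 = (2 * N).+2)%N by lia.
rewrite goellnitz_gfS; last by lia.
rewrite (@goellnitz_gfS _ _ _ (2 * N).+2); last by lia.
have [-> ->] : odd (2 * N).+4 = false /\ odd (2 * N).+3 = true by lia.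
have -> : ((2 * N).+4 - (2 + false) = (2 * N).+2)%N by lia.
have -> : ((2 * N).+3 - (2 + true) = 2 * N)%N by lia.
by ring.
Qed.

(** * The recurrence for the double sum *)

Section DoubleSum.
Variables (F : fieldType) (q : F).
Hypothesis q_neq1 : forall k, (q ^+ 2) ^+ k.+1 != 1.

(* [e] is 1 in the first identity and 0 in the second. *)
Definition summand (e N m n : nat) : F :=
  q ^+ (m ^ 2 + n ^ 2 + n) * qbinomial (q ^+ 2) (N%:Z - m%:Z) n%:Z *
  qbinomial (q ^+ 2) (n + e)%N%:Z m%:Z.

Lemma summand_eq0 (e N m n : nat) : (N < m + n)%N -> summand e N m n = 0.
Proof. by move=> ?; rewrite /summand qbinomial_small ?mulr0 ?mul0r //; lia. Qed.

Lemma summandS0 (e N n : nat) :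
  summand e N.+2 0 n.+1 =
  summand e N.+1 0 n.+1 + q ^+ (2 * N).+4 * summand e N.+1 0 n.
Proof.
(* The exponent in [qbinomial_pascal] equals N+1-n only for n <= N+1; beyond that every term
   vanishes. *)
have [lt|le] := ltnP N.+1 n.
  by rewrite !summand_eq0 ?mulr0 ?addr0 //; lia.
rewrite /summand !subr0 !qbinomialn0 // !mulr1.
have -> : N.+2%:Z = N.+1%:Z + 1 by lia.
rewrite qbinomial_pascal // mulrDr; congr (_ + _).
rewrite !mulrA; congr (_ * _).
by rewrite -exprM -!exprD; congr (q ^+ _); lia.
Qed.

Lemma summandSS (e N m n : nat) :
  summand e N.+2 m.+1 n.+1 =
  summand e N.+1 m.+1 n.+1 + q ^+ (2 * N).+4 * summand e N.+1 m.+1 n +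
  q ^+ (2 * N).+3 * summand e N m n.
Proof.
have [lt|le] := ltnP N (m + n).
  by rewrite !summand_eq0 ?mulr0 ?addr0 //; lia.
rewrite /summand.
have -> : N.+2%:Z - m.+1%:Z = (N%:Z - m%:Z) + 1 by lia.
have -> : N.+1%:Z - m.+1%:Z = N%:Z - m%:Z by lia.
rewrite qbinomial_pascal // mulrDr mulrDl -[RHS]addrA; congr (_ + _).
have -> : (n.+1 + e)%N%:Z = (n + e)%N%:Z + 1 by lia.
(* The weight q^(2(m+1)) keeps the index m+1 and brings the extra exponent to 2N+4; the unweighted
   branch lowers it to m and leaves 2N+3. *)
rewrite qbinomial_pascal_shift // mulrDr; congr (_ + _).
  rewrite !mulrA; congr (_ * _); rewrite mulrAC; congr (_ * _).
  by rewrite -!exprM -!exprD; congr (q ^+ _); lia.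
rewrite !mulrA; congr (_ * _ * _).
by rewrite -exprM -!exprD; congr (q ^+ _); lia.
Qed.

Lemma row_rec (e K N n : nat) : (N < K)%N ->
  \sum_(m < K.+1) summand e N.+2 m n.+1 =
  \sum_(m < K.+1) summand e N.+1 m n.+1 +
  (q ^+ (2 * N).+4 * (\sum_(m < K.+1) summand e N.+1 m n) +
  q ^+ (2 * N).+3 * (\sum_(m < K.+1) summand e N m n)).
Proof.
move=> NK; rewrite [X in _ * X + _]big_ord_recl [X in X = _]big_ord_recl.
rewrite [X in _ = X + _]big_ord_recl [X in _ = _ + (_ + _ * X)]big_ord_recr /=.
(* Shifting m leaves over the term m = K of the sum for N, which is 0 as N < K. *)
rewrite (@summand_eq0 _ _ K); last by lia.
rewrite summandS0; under eq_bigr do rewrite summandSS.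
rewrite !big_split /= -!mulr_sumr; ring.
Qed.

(** The box size [K] is independent of [N], so that consecutive sums can be compared over one index
    range. *)
Definition double_sum (e K N : nat) : F :=
  \sum_(n < K.+1) \sum_(m < K.+1) summand e N m n.

Lemma double_sum_rec (e K N : nat) : (e <= 1)%N -> (N.+1 < K)%N ->
  double_sum e K N.+2 =
  (1 + q ^+ (2 * N).+4) * double_sum e K N.+1 +
  q ^+ (2 * N).+3 * double_sum e K N.
Proof.
move=> e1 NK; rewrite /double_sum.
rewrite mulrDl mul1r -addrA.
rewrite [X in _ * X + _]big_ord_recr [X in _ = _ + (_ + _ * X)]big_ord_recr /=.
rewrite (big1 _ _ (fun m : 'I_K.+1 => summand e N.+1 m K)); last first.
  by move=> m _; rewrite summand_eq0 //; lia.
rewrite (big1 _ _ (fun m : 'I_K.+1 => summand e N m K)); last first.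
  by move=> m _; rewrite summand_eq0 //; lia.
rewrite !addr0 [X in X = _]big_ord_recl [X in _ = X + _]big_ord_recl /=.
have NK' : (N < K)%N by exact: ltnW.
rewrite [X in _ + X = _](eq_bigr _ (fun (n : 'I_K) _ => row_rec e n NK')).
rewrite !big_split /= -!mulr_sumr !addrA; congr (_ + _ + _ + _).
(* The row n = 0 must agree for N+2 and N+1: only m <= e <= 1 contributes, and there the first
   binomial is 1 in both. *)
apply: eq_bigr => m _; rewrite /summand add0n.
have [lt|le] := ltnP e m.
  by rewrite ![qbinomial _ e%:Z _]qbinomial_small ?mulr0 //; lia.
have -> : N.+2%:Z - m%:Z = (N.+2 - m)%N%:Z by lia.
have -> : N.+1%:Z - m%:Z = (N.+1 - m)%N%:Z by lia.
by rewrite !qbinomialn0.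
Qed.

(** Nonzero terms have m + n <= N <= K and so lie in the box. *)
Lemma fsbig_summand (e K N : nat) : (N <= K)%N ->
  \sum_(mn \in [set: nat * nat]) summand e N mn.1 mn.2 = double_sum e K N.
Proof.
move=> NK; rewrite /double_sum exchange_big /=.
rewrite [RHS](eq_bigr _ (fun (m : 'I_K.+1) _ => fsbig_ord _ _ (summand e N m))).
rewrite (fsbig_ord _ _ (fun m => \sum_(n \in `I_K.+1) summand e N m n)).
rewrite pair_fsbig; [|exact: finite_II..].
symmetry; apply: fsbig_widen => // -[m n] [_ /=] mnK.
apply: summand_eq0; rewrite ltnNge; apply/negP => le_mnN; apply: mnK.
by split=> /=; lia.
Qed.

(** The recurrence has order two, hence strong induction with base cases N = 0 and N = 1. *)
Lemma goellnitz_gf_double_sum (e N : nat) : (e <= 1)%N ->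
  goellnitz_gf q (2 - e) (2 * N) =
  \sum_(mn \in [set: nat * nat]) summand e N mn.1 mn.2.
Proof.
move=> e1; elim/ltn_ind: N => -[|[|N]] IHN.
- rewrite (@fsbig_summand _ 0) // goellnitz_gf_small; last by lia.
  by rewrite /double_sum !big_ord1 /summand subr0 !qbinomialn0 // !mulr1.
- rewrite (@fsbig_summand _ 1) // goellnitz_gfS ?muln1; last by lia.
  rewrite (goellnitz_gf_small _ (_ : 2 - (2 + odd 2) < _)%N); last by lia.
  rewrite /double_sum !big_ord_recl !big_ord0 /= !addr0.
  (* The surviving terms are 1, q^2 and, from (m, n) = (1, 0), q times the binomial of [e] over 1:
     the partition with single part 1, present only for e = 1. *)
  rewrite (@summand_eq0 e 1 1 1) // addr0 /summand !subr0 subrr.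
  rewrite !qbinomialn0 // (@qbinomialnn _ _ _ 1) //.
  case: e e1 {IHN} => [|[|//]] _ /=.
    rewrite goellnitz_gf_small // qbinomial_small //.
    by rewrite !mulr1 mulr0 addr0.
  by rewrite goellnitz_gfS // !goellnitz_gf_small // qbinomialnn // !mulr1.
- rewrite goellnitz_gf_rec; last by lia.
  rewrite !IHN; [|lia..].
  rewrite !(@fsbig_summand _ N.+3); [|lia..].
  by rewrite double_sum_rec.
Qed.

End DoubleSum.

(** * Specialisation to the indeterminate, whose square is not a root of unity *)

Lemma qvar_sq_neq1 (k : nat) : (qvar ^+ 2) ^+ k.+1 != 1.
Proof.
rewrite -exprM /qvar -tofracXn -tofrac1 tofrac_eq.
apply/eqP => /(congr1 (fun r : {poly rat} => size r)).
by rewrite size_polyXn size_poly1.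
Qed.

Theorem theorem4p6 (N : nat) :
  let q := qvar in
  (\sum_(p \in little_goellnitz 1 (2 * N)) q ^+ sumn p =
   \sum_(mn \in [set: nat * nat])
     let m := mn.1 in let n := mn.2 in
     q ^+ (m ^ 2 + n ^ 2 + n)%N
       * qbinomial (q ^+ 2) (N%:Z - m%:Z) n%:Z
       * qbinomial (q ^+ 2) (n%:Z + 1) m%:Z)
  /\
  (\sum_(p \in little_goellnitz 2 (2 * N)) q ^+ sumn p =
   \sum_(mn \in [set: nat * nat])
     let m := mn.1 in let n := mn.2 in
     q ^+ (m ^ 2 + n ^ 2 + n)%N
       * qbinomial (q ^+ 2) (N%:Z - m%:Z) n%:Z
       * qbinomial (q ^+ 2) n%:Z m%:Z).
Proof.
split.
  rewrite -[LHS]/(goellnitz_gf qvar (2 - 1) (2 * N)).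
  by rewrite goellnitz_gf_double_sum //; exact: qvar_sq_neq1.
rewrite -[LHS]/(goellnitz_gf qvar (2 - 0) (2 * N)).
rewrite goellnitz_gf_double_sum; [|exact: qvar_sq_neq1|by []].
by apply: eq_fsbigr => -[m n] _; rewrite /summand addn0.
Qed.
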